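(* Let $p$ be an odd prime, $a\in\mathbb Z_p$ with $a\not\equiv-1\pmod p$, and $a'=(a-\langle a\rangle_p)/p$. Then $$\sum_{k=0}^{p-1}\binom ak\binom{-1-a}k\binom{2k}k\frac1{4^k(2k-1)}\equiv-(2a^2+2a+1)S_p(a)-2(a+1)^2S_p(a+1)-2(2a+1)\frac{a'(a'+1)}{a+1}p^3\pmod{p^4}.$$
   Context: For a prime $p$, $\mathbb Z_p$ denotes the set of rational numbers whose denominator is not divisible by $p$, and congruences modulo powers of $p$ are between elements of $\mathbb Z_p$ (the difference divided by that power of $p$ lies in $\mathbb Z_p$). For $a\in\mathbb Z_p$, $\langle a\rangle_p\in\{0,1,\ldots,p-1\}$ is determined by $a\equiv\langle a\rangle_p\pmod p$. For rational $a$ and integer $k\ge0$, $\binom ak=a(a-1)\cdots(a-k+1)/k!$. Define $S_n(a)=\sum_{k=0}^{n-1}\binom ak\binom{-1-a}k\binom{2k}k\frac1{4^k}$ for $n\ge1$. *)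

(* Defs.v *)
From HB Require Import structures.
From mathcomp Require Import all_boot all_order all_algebra.
From mathcomp Require Import ring zify.
Set Implicit Arguments.
Unset Strict Implicit.
Unset Printing Implicit Defensive.
Import Order.TTheory GRing.Theory Num.Theory.
Local Open Scope ring_scope.

(* The localization of the integers at p, as a subset of rat (denq x is the
   positive denominator of x in lowest terms). *)
Definition zloc (p : nat) : {pred rat} := [pred x | ~~ (p %| denq x)%Z].

(* x is congruent to y modulo p ^ m in zloc p. *)
Definition zloc_cong (p m : nat) (x y : rat) : bool :=
  (x - y) / p%:R ^+ m \in zloc p.

(* The least natural number r < p congruent to a modulo p; the junk value p is
   returned when there is none, which zloc_residueP excludes for p prime and a
   in zloc p. *)
Definition zloc_residue (p : nat) (a : rat) : nat :=
  find (fun r => zloc_cong p 1 a r%:R) (iota 0 p).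

Definition ratbin (a : rat) (k : nat) : rat :=
  (\prod_(i < k) (a - i%:R)) / k`!%:R.

Definition S_ (n : nat) (a : rat) : rat :=
  \sum_(k < n) ratbin a k * ratbin (-1 - a) k * 'C(2 * k, k)%:R / 4 ^+ k.

Lemma zlocP (p : nat) (x : rat) : prime p ->
  reflect (exists n d : int, ~~ (p %| d)%Z /\ x = n%:Q / d%:Q) (x \in zloc p).
Proof.
move=> p_pr; apply: (iffP idP) => [xp|[n [d [pd ->]]]].
  by exists (numq x), (denq x); rewrite divq_num_den.
have d0 : d != 0 by apply: contraNneq pd => ->; rewrite dvdz0.
rewrite inE; apply: contra pd => /dvdz_trans; apply.
by case: divqP d0 => [|k x0 k0 _]; rewrite ?eqxx // dvdz_mull.
Qed.

Lemma zloc_residueP (p : nat) (a : rat) : prime p -> a \in zloc p ->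
  (zloc_residue p a < p)%N /\ zloc_cong p 1 a (zloc_residue p a)%:R.
Proof.
move=> p_pr ap.
have p0 : (p%:Z != 0) by rewrite eqz_nat -lt0n prime_gt0.
suff Hs : has (fun r => zloc_cong p 1 a r%:R) (iota 0 p).
  have Hlt := Hs; rewrite has_find size_iota in Hlt; split=> //.
  by move: (nth_find 0 Hs); rewrite nth_iota.
have cop : coprimez (denq a) p.
  by rewrite coprimez_sym coprimezE absz_nat prime_coprime.
have /coprimezP [[u v] /= uv] := cop.
pose r := ((numq a * u) %% p)%Z.
have r0 : 0 <= r by rewrite modz_ge0.
have rp : r < p by rewrite ltz_pmod // ltz_nat prime_gt0.
apply/hasP; exists `|r|%N.
  by rewrite mem_iota /= add0n -ltz_nat gez0_abs.
apply/(zlocP _ p_pr).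
exists (numq a * v + ((numq a * u) %/ p)%Z * denq a), (denq a); split=> //.
have pq : p%:Q != 0 by rewrite intr_eq0.
have dq : (denq a)%:Q != 0 by rewrite intr_eq0 denq_eq0.
have -> : `|r|%N%:R = r%:Q :> rat by rewrite -[in RHS](gez0_abs r0).
have numE : numq a = (numq a * v + (numq a * u %/ p)%Z * denq a) * p + r * denq a.
  rewrite -[LHS]mulr1 -uv mulrDr mulrA {1}(divz_eq (numq a * u) p) -/r.
  by rewrite !mulrDl [in RHS]addrAC !mulrA; lia.
set k := (X in _ = X%:Q / _).
have aE : a = (k * p + r * denq a)%:Q / (denq a)%:Q.
  by rewrite -numE divq_num_den.
rewrite [in LHS]aE expr1 intrD !intrM.
by field; rewrite pq dq.
Qed.

(* Main.v *)
(* Put b = a + 1 and w_k = binom(b, k) binom(-b, k) binom(2k, k) / 4^k.  The k-th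
   terms of S(a) and S(a + 1) are (b - k) w_k / b and (b + k) w_k / b, and
   w_(k+1) / w_k is rational in k, so Gosper summation makes the difference of the
   two sides, without its p^3 term, telescope to
   - 4 (2a + 1) n^3 w_n / ((2n - 1) b).  At n = p only w_p mod p matters, and
   w_p = - a' (a' + 1) / 2 mod p by Lucas' congruence in zloc p and Fermat. *)
Require Import Defs.
From mathcomp Require Import all_boot all_order all_algebra.
From mathcomp Require Import ring zify.
Import GRing.Theory Num.Theory.
Local Open Scope ring_scope.

(** * Arithmetic of the ring [zloc p] and of congruences modulo [p] *)

Section Localization.

Variables (p : nat) (p_prime : prime p).

Lemma natp_neq0 : p%:R != 0 :> rat.
Proof. by rewrite pnatr_eq0 -lt0n prime_gt0. Qed.

Lemma zloc_int (n : int) : n%:~R \in zloc p.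
Proof.
apply/zlocP => //; exists n, 1; rewrite divr1; split=> //.
by rewrite dvdzE dvdn1 neq_ltn prime_gt1 ?orbT.
Qed.

Lemma zloc_nat (n : nat) : n%:R \in zloc p.
Proof. exact: (zloc_int n). Qed.

Lemma Euclid_dvdzM (m n : int) : (p %| m * n)%Z = (p %| m)%Z || (p %| n)%Z.
Proof. by rewrite !dvdzE abszM Euclid_dvdM. Qed.

Lemma ndvdz_neq0 (d : int) : ~~ (p %| d)%Z -> d%:~R != 0 :> rat.
Proof. by apply: contraNneq => /eqP; rewrite intr_eq0 => /eqP ->; rewrite dvdz0. Qed.

Lemma zlocD (x y : rat) : x \in zloc p -> y \in zloc p -> x + y \in zloc p.
Proof.
move=> /(zlocP _ p_prime) [n [d [pd ->]]] /(zlocP _ p_prime) [m [e [pe ->]]].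
apply/zlocP => //; exists (n * e + m * d), (d * e).
split; first by rewrite Euclid_dvdzM negb_or pd.
by rewrite !rmorphD !rmorphM /=; field; rewrite !ndvdz_neq0.
Qed.

Lemma zlocM (x y : rat) : x \in zloc p -> y \in zloc p -> x * y \in zloc p.
Proof.
move=> /(zlocP _ p_prime) [n [d [pd ->]]] /(zlocP _ p_prime) [m [e [pe ->]]].
apply/zlocP => //; exists (n * m), (d * e).
split; first by rewrite Euclid_dvdzM negb_or pd.
by rewrite !rmorphM /=; field; rewrite !ndvdz_neq0.
Qed.

Lemma zlocN (x : rat) : x \in zloc p -> - x \in zloc p.
Proof. by move=> xp; rewrite -mulN1r zlocM // (zloc_int (-1)). Qed.

Lemma zlocB (x y : rat) : x \in zloc p -> y \in zloc p -> x - y \in zloc p.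
Proof. by move=> xp yp; rewrite zlocD // zlocN. Qed.

Lemma zloc_prod (I : Type) (s : seq I) (P : pred I) (F : I -> rat) :
  (forall i, P i -> F i \in zloc p) -> \prod_(i <- s | P i) F i \in zloc p.
Proof. by move=> Fp; elim/big_ind: _ => //; [exact: (zloc_nat 1) | exact: zlocM]. Qed.

(** A factor [p] in the numerator would make [x] congruent to 0, so the flipped fraction has an
    admissible denominator. *)
Lemma zlocV (x : rat) : x \in zloc p -> ~~ zloc_cong p 1 x 0 -> x^-1 \in zloc p.
Proof.
move=> /(zlocP _ p_prime) [n [d [pd ->]]] px.
apply/zlocP => //; exists d, n; split; last by rewrite invf_div.
apply: contra px => /dvdzP [k ->]; apply/zlocP => //; exists k, d; split=> //.
by rewrite subr0 expr1 rmorphM /=; field; rewrite natp_neq0 ndvdz_neq0.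
Qed.

Lemma zloc_natV (n : nat) : ~~ (p %| n)%N -> n%:R^-1 \in zloc p.
Proof. by move=> pn; apply/zlocP => //; exists 1, n; rewrite div1r dvdzE. Qed.

Lemma zloc_cong1P (x y : rat) :
  reflect (exists2 z, z \in zloc p & x = y + p%:R * z) (zloc_cong p 1 x y).
Proof.
rewrite /zloc_cong expr1; apply: (iffP idP) => [h|[z zp ->]].
  by exists ((x - y) / p%:R) => //; field; rewrite natp_neq0.
by rewrite (_ : _ / _ = z) //; field; rewrite natp_neq0.
Qed.

Lemma zloc_congM (x y z t : rat) : x \in zloc p -> t \in zloc p ->
  zloc_cong p 1 x y -> zloc_cong p 1 z t -> zloc_cong p 1 (x * z) (y * t).
Proof.
move=> xp tp xy zt; rewrite /zloc_cong.
have -> : (x * z - y * t) / p%:R ^+ 1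
    = x * ((z - t) / p%:R ^+ 1) + (x - y) / p%:R ^+ 1 * t.
  by field; rewrite natp_neq0.
by rewrite zlocD // zlocM.
Qed.

Lemma zloc_congD (x y z t : rat) :
  zloc_cong p 1 x y -> zloc_cong p 1 z t -> zloc_cong p 1 (x + z) (y + t).
Proof. by move=> h k; rewrite /zloc_cong opprD addrACA mulrDl zlocD. Qed.

End Localization.

(** * Recurrences for binomial coefficients with rational upper entry *)

Lemma ratbinS (x : rat) (k : nat) :
  ratbin x k.+1 = ratbin x k * (x - k%:R) / k.+1%:R.
Proof.
rewrite /ratbin big_ord_recr factS natrM /=.
by field; rewrite !pnatr_eq0 -lt0n fact_gt0 nat1r pnatr_eq0.
Qed.

(** Both sides are (x + 1) x (x - 1) ... (x + 1 - k) / k!; this is absorption in a form free of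
    division by x + 1 - k. *)
Lemma ratbinD1 (x : rat) (k : nat) :
  ratbin (x + 1) k * (x + 1 - k%:R) = (x + 1) * ratbin x k.
Proof.
rewrite /ratbin mulrAC mulrA; congr (_ / _).
rewrite -[LHS](big_ord_recr k (fun i => x + 1 - i%:R)) big_ord_recl subr0.
by congr (_ * _); apply: eq_bigr => i _; rewrite lift0 -natr1; ring.
Qed.

Lemma ratbin_pascal (x : rat) (k : nat) :
  ratbin (x + 1) k.+1 = ratbin x k.+1 + ratbin x k.
Proof.
rewrite ratbinS ratbinD1 ratbinS.
by field; rewrite nat1r pnatr_eq0.
Qed.

(** Both sides obey Pascal's rule. This makes Lucas' congruence for [ratbin] available for the
    central binomial coefficient. *)
Lemma ratbin_nat (n k : nat) : ratbin n%:R k = 'C(n, k)%:R.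
Proof.
elim: n k => [|n IHn] [|k].
- by rewrite /ratbin big_ord0 divr1.
- by rewrite /ratbin big_ord_recl subrr !mul0r.
- by rewrite /ratbin big_ord0 divr1 bin0.
- by rewrite -natr1 ratbin_pascal !IHn binS natrD.
Qed.

(** * The congruences of Lucas and Fermat modulo [p] *)

Lemma fact_prime_ndvd (p k : nat) : prime p -> (k < p)%N -> ~~ (p %| k`!)%N.
Proof.
move=> p_prime; elim: k => [|k IHk] kp; first by rewrite dvdn1 neq_ltn prime_gt1 ?orbT.
by rewrite factS Euclid_dvdM // negb_or gtnNdvd // IHk // ltnW.
Qed.

(** As p - 1 is even, the signs cancel and binom(x - 1, p - 1) is the product of the 1 - x / i for 0
    < i < p. Each factor is 1 mod p, since p divides x and i is a unit. *)
Lemma ratbin_predp_multiple (p : nat) (x : rat) : prime p -> odd p ->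
  x / p%:R \in zloc p -> zloc_cong p 1 (ratbin (x - 1) p.-1) 1.
Proof.
move=> p_prime p_odd xp.
have fact_prod n : n`!%:R = \prod_(i < n) (i.+1)%:R :> rat.
  by elim: n => [|n IHn]; rewrite ?big_ord0 // big_ord_recr factS natrM IHn mulrC.
have even_p1 : ~~ odd p.-1 by case: (p) p_odd.
have -> : ratbin (x - 1) p.-1 = \prod_(i < p.-1) (1 - x / i.+1%:R).
  rewrite -[RHS]mul1r -[1 in LHS](opprK 1) -[X in X * _](expr1n _ p.-1).
  rewrite (_ : 1 ^+ p.-1 = (-1) ^+ p.-1 :> rat); last
    by rewrite expr1n -signr_odd (negbTE even_p1).
  rewrite -[X in (-1) ^+ X]card_ord -prodr_const -big_split /=.
  rewrite /ratbin fact_prod -prodf_div; apply: eq_bigr => i _.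
  by rewrite -natr1; field; rewrite natr1 pnatr_eq0.
have zp (i : 'I_p.-1) : x / i.+1%:R / p%:R \in zloc p.
  rewrite mulrAC zlocM // zloc_natV // gtnNdvd //.
  by case: (i) => j /=; case: (p) p_prime.
(* Multiplying congruences requires members of [zloc p], so membership is carried through the
   product along with the congruence. *)
suff: (\prod_(i < p.-1) (1 - x / i.+1%:R) \in zloc p) &&
      zloc_cong p 1 (\prod_(i < p.-1) (1 - x / i.+1%:R)) 1 by case/andP.
elim/big_ind: _ => [|y z /andP[y0 y1] /andP[z0 z1]|i _].
- by rewrite (zloc_nat _ p_prime 1) /zloc_cong subrr mul0r (zloc_nat _ p_prime 0).
- rewrite zlocM //= -[X in zloc_cong _ _ _ X](mulr1 1) zloc_congM //.
  exact: (zloc_nat _ p_prime 1).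
- have pz := natp_neq0 _ p_prime.
  rewrite /zloc_cong expr1 addrAC subrr add0r mulNr [X in _ && X]zlocN ?zp // andbT.
  rewrite -[x / _](divfK pz) zlocB //.
    exact: (zloc_nat _ p_prime 1).
  by rewrite zlocM ?zp ?zloc_nat.
Qed.

(* Lucas' congruence in zloc p; by Pascal's rule the class of binom(x, p) does
   not change when x moves to x + 1 inside a block r = 0, ..., p - 1, so the
   case p | x suffices. *)
Lemma lucas_ratbin (p r : nat) (x : rat) : prime p -> odd p -> (r < p)%N ->
  (x - r%:R) / p%:R \in zloc p ->
  zloc_cong p 1 (ratbin x p) ((x - r%:R) / p%:R).
Proof.
move=> p_prime p_odd; have pz := natp_neq0 _ p_prime.
have pS : p = p.-1.+1 by rewrite prednK // prime_gt0.
elim: r x => [|r IHr] x rp.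
  rewrite subr0 => xp.
  (* Absorption extracts the quotient x / p, and the cofactor is 1 mod p. *)
  have -> : ratbin x p = x / p%:R * ratbin (x - 1) p.-1.
    have := ratbinD1 (x - 1) p.-1; rewrite subrK => e.
    rewrite {1}pS ratbinS -pS mulrAC; apply: (mulIf pz).
    rewrite mulrAC (mulrAC (x / _)) !divfK // e.
  rewrite -[X in zloc_cong _ _ _ X]mulr1 zloc_congM ?ratbin_predp_multiple //.
    exact: (zloc_nat _ p_prime 1).
  by rewrite /zloc_cong subrr mul0r (zloc_nat _ p_prime 0).
have -> : x - r.+1%:R = (x - 1) - r%:R by rewrite -natr1; ring.
move=> xp; have -> : ratbin x p = ratbin (x - 1) p + ratbin (x - 1) p.-1.
  by rewrite [in LHS]pS -{1}(subrK 1 x) ratbin_pascal -pS.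
rewrite -[X in zloc_cong _ _ _ X]addr0.
rewrite zloc_congD ?IHr 1?ltnW //.
have rp1 : (r < p.-1)%N by rewrite -ltnS -pS.
(* The extra Pascal term binom(x - 1, p - 1) vanishes mod p: the factor of index [r] in its
   numerator is divisible by p, and (p - 1)! is a unit. *)
rewrite /zloc_cong subr0 expr1 /ratbin (bigD1 (Ordinal rp1)) //=.
set P := \prod_(i < _ | _) _.
have -> : (x - 1 - r%:R) * P / (p.-1)`!%:R / p%:R
  = (x - 1 - r%:R) / p%:R * (P * (p.-1)`!%:R^-1).
  by field; rewrite pz pnatr_eq0 -lt0n fact_gt0.
rewrite zlocM // zlocM ?zloc_natV ?fact_prime_ndvd // -?pS //.
have x1p : x - 1 \in zloc p.
  rewrite -[x - 1](subrK r%:R) -[x - 1 - _](divfK pz).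
  by rewrite zlocD ?zloc_nat // zlocM ?zloc_nat.
by apply: zloc_prod => // i _; rewrite zlocB ?zloc_nat.
Qed.

Lemma fermat4 (p : nat) : prime p -> zloc_cong p 1 (4 ^+ p) 4.
Proof.
move=> p_prime.
have le4 : (4 <= 4 ^ p)%N.
  by rewrite -[X in (X <= _)%N]expn1 leq_exp2l // prime_gt0.
have /eqP := fermat_little 4 p_prime; rewrite eqn_mod_dvd // => /dvdnP [q e].
apply/zloc_cong1P => //; exists q%:R; first exact: zloc_nat.
by rewrite -natrX -(subnK le4) e natrD natrM addrC mulrC.
Qed.

(** * Closed form of the telescoping sum *)

Lemma two_natrB1_neq0 (k : nat) : 2 * k%:R - 1 != 0 :> rat.
Proof.
rewrite subr_eq0 -natrM (eqr_nat _ _ 1); apply/eqP => /(congr1 odd).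
by rewrite oddM.
Qed.

(** Pascal's rule and symmetry give binom(2k + 2, k + 1) = 2 binom(2k + 1, k + 1); absorption then
    lowers the row to 2k. *)
Lemma natr_bin2 (k : nat) :
  'C(2 * k.+1, k.+1)%:R = 'C(2 * k, k)%:R * (2 * (2 * k%:R + 1)) / k.+1%:R :> rat.
Proof.
have k1 : k.+1%:R != 0 :> rat by rewrite pnatr_eq0.
apply: (mulIf k1); rewrite divfK //.
have -> : 2 * (2 * k%:R + 1) = (2 * (2 * k).+1)%:R :> rat.
  by rewrite natrM -(natr1 (2 * k)) natrM.
rewrite -!natrM; congr (_%:R).
have -> : 'C(2 * k.+1, k.+1) = (2 * 'C((2 * k).+1, k.+1))%N.
  rewrite mulnS add2n binS -[X in (_ + X)%N]bin_sub; last by lia.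
  by rewrite (_ : (2 * k).+1 - k = k.+1)%N ?mul2n ?addnn //; lia.
by have := mul_bin_diag (2 * k).+1 k; rewrite /=; lia.
Qed.

(** Induction checks the Gosper antiderivative: both sides vanish at n = 0, and the increment of the
    right side is the combined n-th term. *)
Lemma sum_closed_form (n : nat) (a : rat) : a + 1 != 0 ->
  \sum_(k < n) ratbin a k * ratbin (-1 - a) k * 'C(2 * k, k)%:R
               / (4 ^+ k * (2 * k%:R - 1))
  + (2 * a ^+ 2 + 2 * a + 1) * S_ n a + 2 * (a + 1) ^+ 2 * S_ n (a + 1)
  = - 4 * (2 * a + 1) * n%:R ^+ 3 / ((2 * n%:R - 1) * (a + 1))
    * (ratbin (a + 1) n * ratbin (-1 - a) n * 'C(2 * n, n)%:R / 4 ^+ n).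
Proof.
move=> b0; rewrite /S_.
elim: n => [|n IHn]; first by rewrite !big_ord0 expr0n /= !mulr0 !mul0r !addr0.
rewrite !big_ord_recr /=.
(* [e1] and [e2] reduce the binomials with upper entries a and -2 - a to those occurring in w_n. *)
have e1 : ratbin a n = ratbin (a + 1) n * (a + 1 - n%:R) / (a + 1).
  by rewrite ratbinD1 mulrC mulKf.
have e2 : ratbin (-1 - (a + 1)) n = ratbin (-1 - a) n * (a + 1 + n%:R) / (a + 1).
  have := ratbinD1 (-1 - (a + 1)) n.
  have -> : -1 - (a + 1) + 1 = -1 - a by ring.
  move=> e; apply: (mulIf b0); rewrite divfK //.
  transitivity (- ((-1 - a) * ratbin (-1 - (a + 1)) n)); first by ring.
  by rewrite -e; ring.
move: IHn; set A := \sum_(k < n) _; set B := \sum_(k < n) _.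
set C := \sum_(k < n) _ => IHn.
have split3 (q s u v w : rat) :
    A + u + q * (B + v) + s * (C + w) = A + q * B + s * C + (u + q * v + s * w) by ring.
rewrite split3 IHn.
rewrite e1 e2 natr_bin2 !ratbinS (exprS 4 n).
have k1 := two_natrB1_neq0 n; have k2 := two_natrB1_neq0 n.+1.
have n1 : n.+1%:R != 0 :> rat by rewrite pnatr_eq0.
have f4 : 4 ^+ n != 0 :> rat by rewrite expf_neq0.
rewrite -(natr1 n) in k2 n1 *.
(* The factors of w_n become indeterminates, leaving an identity of rational functions. *)
move: (ratbin (a + 1) n) (ratbin (-1 - a) n) ('C(2 * n, n)%:R) (4 ^+ n) f4 => U V W F f4.
by field; rewrite f4 b0 k1 k2 n1.
Qed.

(** * Descent from modulus [p ^ 4] to modulus [p] *)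

Theorem theorem5p1 (p : nat) (a : rat)
    (p_prime : prime p) (p_odd : odd p)
    (a_zloc : a \in zloc p) (a_neqN1 : ~~ zloc_cong p 1 a (-1)) :
  let a' := (a - (zloc_residue p a)%:R) / p%:R in
  zloc_cong p 4
    (\sum_(k < p) ratbin a k * ratbin (-1 - a) k * 'C(2 * k, k)%:R
                  / (4 ^+ k * (2 * k%:R - 1)))
    (- (2 * a ^+ 2 + 2 * a + 1) * S_ p a
     - 2 * (a + 1) ^+ 2 * S_ p (a + 1)
     - 2 * (2 * a + 1) * (a' * (a' + 1) / (a + 1)) * p%:R ^+ 3).
Proof.
cbv zeta; set r := zloc_residue p a; set a' := (a - r%:R) / p%:R.
have pz := natp_neq0 _ p_prime; have z1 := zloc_nat _ p_prime 1.
have [rp ar] := zloc_residueP p_prime a_zloc; rewrite -/r in rp ar.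
have a'p : a' \in zloc p by move: ar; rewrite /zloc_cong expr1.
(* Since a is not -1 mod p, adding 1 does not leave the block: a + 1 has residue r + 1 and the same
   quotient a'. *)
have rp1 : (r.+1 < p)%N.
  rewrite ltn_neqAle rp andbT; apply: contra a_neqN1 => /eqP r1.
  apply/zloc_cong1P => //; exists (a' + 1); first by rewrite zlocD.
  by rewrite /a' -[in p%:R * _]r1 -natr1; field; rewrite natr1 pnatr_eq0.
have bp : a + 1 \in zloc p by rewrite zlocD.
have bN0 : ~~ zloc_cong p 1 (a + 1) 0.
  by apply: contra a_neqN1; rewrite /zloc_cong subr0 opprK.
have b0 : a + 1 != 0.
  by apply: contraNneq bN0 => ->; rewrite /zloc_cong subrr mul0r (zloc_nat _ p_prime 0).
have X1 : zloc_cong p 1 (ratbin (a + 1) p) a'.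
  have e : (a + 1 - r.+1%:R) / p%:R = a' by rewrite /a' -natr1; congr (_ / _); ring.
  by rewrite -e lucas_ratbin ?e.
(* Here -1 - a = (p - 1 - r) + p (- a' - 1), with p - 1 - r in the range of residues. *)
have Y1 : zloc_cong p 1 (ratbin (-1 - a) p) (- a' - 1).
  have e : (-1 - a - (p - r.+1)%:R) / p%:R = - a' - 1.
    by rewrite /a' natrB 1?ltnW // -natr1; field.
  by rewrite -e lucas_ratbin ?e ?zlocB ?zlocN //; lia.
have Z1 : zloc_cong p 1 'C(2 * p, p)%:R 2.
  have e : ((2 * p)%:R - 0%:R) / p%:R = 2 :> rat by rewrite natrM subr0 mulfK.
  by rewrite -ratbin_nat -[X in zloc_cong _ _ _ X]e lucas_ratbin ?e ?prime_gt0 ?zloc_nat.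
have F1 := fermat4 _ p_prime.
have [x xp X] := zloc_cong1P _ p_prime _ _ X1.
have [y yp Y] := zloc_cong1P _ p_prime _ _ Y1.
have [z zp Z] := zloc_cong1P _ p_prime _ _ Z1.
have [f fp F] := zloc_cong1P _ p_prime _ _ F1.
have k1 := two_natrB1_neq0 p.
have V1 : (2 * p%:R - 1)^-1 \in zloc p.
  have -> : 2 * p%:R - 1 = (p + p.-1)%:R :> rat.
    by rewrite natrD -subn1 natrB ?prime_gt0 //; ring.
  have p1 : (0 < p.-1)%N by rewrite -ltnS prednK ?prime_gt1 ?prime_gt0.
  by rewrite zloc_natV // dvdn_addr // gtnNdvd // prednK ?prime_gt0.
have V4 : (4 ^+ p)^-1 \in zloc p.
  rewrite -natrX zloc_natV // Euclid_dvdX // (Euclid_dvdM 2 2 p_prime) orbb.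
  rewrite prime_gt0 // andbT dvdn_prime2 //.
  by apply: contraTneq p_odd => ->.
have f4 : 4 ^+ p != 0 :> rat by rewrite expf_neq0.
set A := \sum_(k < p) _.
have {A}-> : A = - 4 * (2 * a + 1) * p%:R ^+ 3 / ((2 * p%:R - 1) * (a + 1))
    * (ratbin (a + 1) p * ratbin (-1 - a) p * 'C(2 * p, p)%:R / 4 ^+ p)
    - (2 * a ^+ 2 + 2 * a + 1) * S_ p a - 2 * (a + 1) ^+ 2 * S_ p (a + 1).
  by rewrite -sum_closed_form // -/A; ring.
(* With c = a' (a' + 1), [w] is (-2 binom(a + 1, p) binom(-1 - a, p) binom(2p, p) + (2p - 1) 4^p c)
   / p. The constant terms 4c and -4c cancel, and the errors [x], [y], [z], [f] of the four
   congruences remain. *)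
pose w := - 2 * (x * ratbin (-1 - a) p * 'C(2 * p, p)%:R
  + a' * y * 'C(2 * p, p)%:R - a' * (a' + 1) * z)
  + 2 * (4 ^+ p) * (a' * (a' + 1)) - f * (a' * (a' + 1)).
(* Three factors p come from the n^3 of the closed form and the fourth from [w]; all the
   denominators left are units. *)
rewrite /zloc_cong [X in X \in _](_ : _ = 2 * (2 * a + 1) * (a + 1)^-1
    * (2 * p%:R - 1)^-1 * (4 ^+ p)^-1 * w); last first.
  have -> : w = (- 2 * (ratbin (a + 1) p * ratbin (-1 - a) p * 'C(2 * p, p)%:R)
      + (2 * p%:R - 1) * 4 ^+ p * (a' * (a' + 1))) / p%:R.
    by apply: (mulIf pz); rewrite divfK // /w X Y Z F; ring.
  by field; rewrite f4 k1 b0 pz.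
have c1 := zlocD _ p_prime _ _ a'p z1.
have ac := zlocM _ p_prime _ _ a'p c1.
have Yp : ratbin (-1 - a) p \in zloc p.
  by rewrite Y zlocD ?zlocB ?zlocN // zlocM // zloc_nat.
have n2 := zloc_nat _ p_prime 2.
have wp : w \in zloc p.
  rewrite /w zlocB //; last by rewrite zlocM.
  rewrite zlocD //; last by rewrite zlocM // zlocM // -natrX zloc_nat.
  rewrite zlocM ?zlocN // zlocB //; last by rewrite zlocM.
  by rewrite zlocD // zlocM ?zloc_nat // zlocM.
have Vb := zlocV _ p_prime _ bp bN0.
rewrite zlocM // zlocM // zlocM // zlocM // zlocM //.
by rewrite zlocD // zlocM.
Qed.
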